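(* Let $I \subseteq \mathbb{R}$ be an interval, let $f \in MT(I)$, let $a,b \in I$ with $a<b$, and suppose $f \in L_1[a,b]$. Then $$\frac{\pi}{2} f\left(\frac{a+b}{2}\right) \leq f(a)+f(b).$$
   Context: A function $f: I \subseteq \mathbb{R} \to \mathbb{R}$ is said to belong to the class $MT(I)$ (to be $MT$-convex on $I$) if it is nonnegative and for all $x,y \in I$ and all $t \in (0,1)$ it satisfies $$f(tx+(1-t)y) \leq \frac{\sqrt{t}}{2\sqrt{1-t}} f(x) + \frac{\sqrt{1-t}}{2\sqrt{t}} f(y).$$ $L_1[a,b]$ denotes the Lebesgue integrable functions on $[a,b]$. *)

(* Defs.v *)
From mathcomp Require Import all_boot all_order all_algebra.
From mathcomp Require Import all_classical all_reals all_analysis.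

Set Implicit Arguments.
Unset Strict Implicit.
Unset Printing Implicit Defensive.

Import Order.TTheory GRing.Theory Num.Theory.
Local Open Scope classical_set_scope.
Local Open Scope ring_scope.

(* A function I -> R is encoded by a total function R -> R whose values outside
   I are irrelevant. *)
Definition MT_convex (R : realType) (I : set R) (f : R -> R) : Prop :=
  (forall x : R, I x -> 0 <= f x) /\
  (forall x y t : R, I x -> I y -> 0 < t < 1 ->
     f (t * x + (1 - t) * y) <=
       Num.sqrt t / (2 * Num.sqrt (1 - t)) * f x +
       Num.sqrt (1 - t) / (2 * Num.sqrt t) * f y).

(* The completed measure is used because [lebesgue_measure] lives on the Borel
   sigma-algebra, whereas functions in L_1[a, b] need only be Lebesgue
   measurable. *)
Definition L1_on (R : realType) (a b : R) (f : R -> R) : Prop :=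
  (@completed_lebesgue_measure R).-integrable `[a, b] (EFin \o f).

(* Main.v *)
(* Taking t = 1/2 in the definition of MT-convexity gives 2 f((a+b)/2) <= f a + f b,
   which is stronger than the claim because f >= 0 and pi/2 <= 2. *)
Require Import Defs.
From mathcomp Require Import all_boot all_order all_algebra.
From mathcomp Require Import all_classical all_reals all_analysis.
From mathcomp Require Import ring lra.

Import Order.TTheory GRing.Theory Num.Theory.
Local Open Scope classical_set_scope.
Local Open Scope ring_scope.

(** At [t = 1/2] the two square roots coincide, so both MT weights equal 1/2 and MT-convexity
    becomes midpoint convexity. Its constant 2 beats [pi / 2], and nonnegativity of [f] at the
    midpoint lets the constant be lowered. *)

Lemma MT_convex_midpoint (R : realType) (I : set R) (f : R -> R) (x y : R) :
  MT_convex I f -> I x -> I y -> 2 * f ((x + y) / 2) <= f x + f y.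
Proof.
move=> [_ f_MT] Ix Iy.
have half01 : 0 < (2^-1 : R) < 1 by lra.
have := f_MT x y 2^-1 Ix Iy half01.
have -> : 1 - 2^-1 = 2^-1 :> R by field.
have -> : 2^-1 * x + 2^-1 * y = (x + y) / 2 by field.
(* Lets [field] cancel the common root in the weight. *)
have s0 : Num.sqrt (2^-1 : R) != 0 by rewrite gt_eqF // sqrtr_gt0; lra.
have -> : Num.sqrt 2^-1 / (2 * Num.sqrt 2^-1) = 2^-1 :> R by field.
lra.
Qed.

Theorem theorem3 (R : realType) (I : set R) (f : R -> R) (a b : R)
  (I_itv : is_interval I) (f_MT : MT_convex I f)
  (Ia : I a) (Ib : I b) (ab : a < b) (f_L1 : L1_on a b f) :
  pi / 2 * f ((a + b) / 2) <= f a + f b.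
Proof.
(* [f] is known to be nonnegative only on [I], so the midpoint must be placed there. *)
have Im : I ((a + b) / 2) by apply: (I_itv a b) => //; lra.
have fm0 : 0 <= f ((a + b) / 2) by case: f_MT => f0 _; exact: f0.
apply: le_trans (MT_convex_midpoint _ _ _ _ _ f_MT Ia Ib).
apply: ler_wpM2r => //.
exact: ltW (pihalf_lt2 R).
Qed.
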